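(* Let $n\ge 2$ be an integer, let $A\subseteq\mathbb{F}_{2^{n-1}}\setminus\{0\}$ with $|A|=k$ and $0<k<2^{n-1}-3$, and let $\overline{A}^*$ be the complement of $A$ in $\mathbb{F}_{2^{n-1}}\setminus\{0\}$. Suppose $r(\overline{A}^* )\neq|\overline{A}^*|\,(|\overline{A}^*|-1)$. Then there exists a subset of $\mathbb{F}_{2^n}\setminus\{0\}$ of size $k+4$ whose $r$-value is $r(A)+12$.
   Context: For a subset $X$ of a finite additive abelian group, the $r$-value $r(X)$ is the number of ordered pairs $(x,y)\in X\times X$ with $x+y\in X$. Only the additive group of $\mathbb{F}_{2^n}$ is used: its elements are written as vectors $[\alpha_1,\dots,\alpha_n]$ with $\alpha_i\in\{0,1\}$ and addition coordinatewise modulo 2. By convention $\mathbb{F}_{2^{n-1}}$ is regarded as the subset of $\mathbb{F}_{2^n}$ consisting of the vectors with first coordinate $\alpha_1=0$. *)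

(* Defs.v *)
From mathcomp Require Import all_boot all_order all_algebra.

Set Implicit Arguments.
Unset Strict Implicit.
Unset Printing Implicit Defensive.

Import GRing.Theory.
Local Open Scope ring_scope.

Definition r_value (G : finZmodType) (X : {set G}) : nat :=
  #|[set p : G * G | [&& p.1 \in X, p.2 \in X & p.1 + p.2 \in X]]|.

(* The additive group of the field with 2 ^ n elements, as coordinate vectors;
   its multiplication plays no role. *)
Notation F2vec n := 'rV['F_2]_n.

(* The copy of F_{2^(n-1)} inside F_{2^n}: vectors whose first coordinate
   (index 0) vanishes. The guarded quantifier lets n be an arbitrary nat; it
   is vacuous only when n = 0. *)
Definition subF2 (n : nat) : {set F2vec n} :=
  [set v : F2vec n | [forall i : 'I_n, (i == 0%N :> nat) ==> (v 0 i == 0)]].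

Definition compl_star (n : nat) (A : {set F2vec n}) : {set F2vec n} :=
  (subF2 n :\ 0) :\: A.

(* Main.v *)
Require Import Defs.
From mathcomp Require Import all_boot all_order all_algebra.

Set Implicit Arguments.
Unset Strict Implicit.
Unset Printing Implicit Defensive.

Import GRing.Theory.
Local Open Scope ring_scope.

(** If [C], the complement of [A] in [H \ {0}], were closed under sums of
    distinct elements, its r-value would be [#|C| * (#|C| - 1)]
    ([r_value_sum_closed]).  So the hypothesis provides [x != y] in [C] with
    [x + y] outside [C], that is, in [A].  The Klein four-group
    [V = {0, x, y, x + y}] therefore meets [A] in exactly one point.  Add to
    [A] a coset [v + V] with [v] outside [H].

    In characteristic 2 the condition that [x], [y], [x + y] lie in a set is
    symmetric in the three places.  By parity of the number of points outside
    [H], a triple not contained in [A] has exactly two entries in [v + V] and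
    one in [A]; the entry in [A] may be in any of three places.  Two points
    of the coset differ by an element of [V], each element of [V] arising
    [#|V|] times, so the r-value grows by [3 * #|V| * #|V :&: A| = 12]
    ([r_value_setU_coset]). *)

Section SumTriples.

Variable G : finZmodType.
Implicit Types X Y Z A H V : {set G}.

(** The r-value with the three places decoupled, so that it can be expanded
    over a disjoint union one place at a time. *)
Definition sum_triples X Y Z : nat :=
  #|[set p : G * G | [&& p.1 \in X, p.2 \in Y & p.1 + p.2 \in Z]]|.

Lemma sum_triplesC X Y Z : sum_triples X Y Z = sum_triples Y X Z.
Proof.
have swapK : involutive (fun p : G * G => (p.2, p.1)) by case.
rewrite /sum_triples -(card_preimset _ (inv_inj swapK)).
by apply: eq_card => -[x y]; rewrite !inE /= andbCA addrC.
Qed.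

Lemma sum_triplesUl X1 X2 Y Z : [disjoint X1 & X2] ->
  sum_triples (X1 :|: X2) Y Z = (sum_triples X1 Y Z + sum_triples X2 Y Z)%N.
Proof.
move=> dX; rewrite /sum_triples -cardsUI addnC.
rewrite [X in (X + _)%N](_ : _ = 0)%N ?add0n; last first.
  apply/eqP; rewrite cards_eq0; apply/eqP/setP => -[x y]; rewrite !inE /=.
  apply/negP => /andP[/and3P[xX1 _ _] /and3P[xX2 _ _]].
  by move: (disjointFr dX xX1); rewrite xX2.
by apply: eq_card => -[x y]; rewrite !inE /= andb_orl.
Qed.

Lemma sum_triples0 X Y Z :
  {in X & Y, forall x y, x + y \notin Z} -> sum_triples X Y Z = 0%N.
Proof.
move=> noZ; apply/eqP; rewrite cards_eq0; apply/eqP/setP => -[x y].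
rewrite !inE /=; apply/negP => /and3P[xX yY].
by apply/negP/noZ.
Qed.

(** Closure under sums of distinct elements makes every off-diagonal pair
    count, while the diagonal pairs sum to [0], which is not in [X]. *)
Lemma r_value_sum_closed X : (forall x : G, x + x = 0) -> 0 \notin X ->
  {in X &, forall x y, x != y -> x + y \in X} ->
  r_value X = (#|X| * (#|X| - 1))%N.
Proof.
move=> addxx X0 closedX; rewrite mulnBr muln1 -cardsX.
have inj_diag : injective (fun x : G => (x, x)) by move=> x y [].
rewrite -(card_imset (mem X) inj_diag) -cardsDS; last first.
  by apply/subsetP => _ /imsetP[x xX ->]; rewrite !inE /= xX.
apply: eq_card => -[x y]; rewrite !inE /=.
case xX: (x \in X); case yX: (y \in X); rewrite ?andbF //= andbT.
have [<-|neq_xy] := eqVneq x y.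
  by rewrite addxx (negPf X0) imset_f.
rewrite closedX //; apply/esym/negP => /imsetP[z _ [xz yz]].
by rewrite xz yz eqxx in neq_xy.
Qed.

Section CharacteristicTwo.

Hypothesis addxx : forall x : G, x + x = 0.

Lemma add2K (x y : G) : x + y + y = x.
Proof. by rewrite -addrA addxx addr0. Qed.

(** [(x, y)] and [(x + y, y)] are exchanged by an involution because
    [x + y + y = x]. *)
Lemma sum_triples_rev X Y Z : sum_triples X Y Z = sum_triples Z Y X.
Proof.
have shearK : involutive (fun p : G * G => (p.1 + p.2, p.2)).
  by move=> [x y]; rewrite /= add2K.
rewrite /sum_triples -(card_preimset _ (inv_inj shearK)).
apply: eq_card => -[x y]; rewrite !inE /= add2K.
by case: (y \in Y); rewrite /= ?andbF // andbC.
Qed.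

Lemma sum_triples_coset V A (v : G) :
  {in V &, forall s t, s + t \in V} ->
  sum_triples [set v + s | s in V] [set v + s | s in V] A
    = (#|V| * #|V :&: A|)%N.
Proof.
move=> addV; set T := [set v + s | s in V].
have addvK : cancel (+%R v) (+%R v) by move=> s; rewrite addrA addxx add0r.
have inT z : (z \in T) = (v + z \in V).
  by rewrite /T (can_imset_pre _ addvK) inE.
(* A pair of points of the coset is a point and the difference, in V, that
   leads from it to the other one. *)
have shearK : involutive (fun p : G * G => (p.1, p.1 + p.2)).
  by move=> [x y]; rewrite /= addrA addxx add0r.
rewrite -(card_imset (mem V) (can_inj addvK)) -cardsX.
rewrite /sum_triples -(card_preimset _ (inv_inj shearK)).
apply: eq_card => -[x y]; rewrite !inE /= !addrA addxx add0r -/T !inT.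
case vxV: (v + x \in V) => //=.
case: (y \in A); rewrite ?andbF ?andbT //.
rewrite addrA; apply/idP/idP => [vxyV|yV]; last exact: addV.
by have := addV _ _ vxV vxyV; rewrite addrA addxx add0r.
Qed.

(** Of the eight patterns for the places [x], [y], [x + y], those with an odd
    number of entries in the coset [v + V] are empty, because [H] is closed
    and [v + V] avoids it while its pairwise sums fall in [H].  The three
    patterns with two such entries are equinumerous by symmetry. *)
Lemma r_value_setU_coset H A V (v : G) :
  {in H &, forall s t, s + t \in H} -> A \subset H -> V \subset H ->
  {in V &, forall s t, s + t \in V} -> v \notin H ->
  r_value (A :|: [set v + s | s in V])
    = (r_value A + 3 * (#|V| * #|V :&: A|))%N.
Proof.
move=> addH /subsetP sAH /subsetP sVH addV vH.
rewrite -(sum_triples_coset A v addV); set T := [set v + s | s in V].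
have TH t : t \in T -> t \notin H.
  case/imsetP => s sV ->; apply: contra vH => vsH.
  by rewrite -(add2K v s); apply: addH => //; apply: sVH.
have TTH : {in T &, forall s t, s + t \in H}.
  move=> _ _ /imsetP[s sV ->] /imsetP[t tV ->].
  by rewrite addrACA addxx add0r; apply: addH; apply: sVH.
have dAT : [disjoint A & T].
  by rewrite disjoint_subset; apply/subsetP => x /sAH; apply/contraL/TH.
have AAT : sum_triples A A T = 0%N.
  apply: sum_triples0 => x y xA yA; apply/negP => /TH/negP; apply.
  by apply: addH; apply: sAH.
have TTT : sum_triples T T T = 0%N.
  by apply: sum_triples0 => x y xT yT; apply: contraL (TTH _ _ xT yT) => /TH.
have expand_last X Y :
    sum_triples X Y (A :|: T) = (sum_triples X Y A + sum_triples X Y T)%N.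
  by rewrite sum_triples_rev sum_triplesUl // !(sum_triples_rev _ _ X).
have expand_mid X :
    sum_triples X (A :|: T) (A :|: T)
      = (sum_triples X A A + sum_triples X A T
         + (sum_triples X T A + sum_triples X T T))%N.
  by rewrite sum_triplesC sum_triplesUl // !(sum_triplesC _ X) !expand_last.
change (sum_triples (A :|: T) (A :|: T) (A :|: T)
  = (sum_triples A A A + 3 * sum_triples T T A)%N).
rewrite sum_triplesUl // !expand_mid AAT TTT.
rewrite (sum_triplesC A T A) (sum_triples_rev T A A) AAT.
rewrite (sum_triplesC T A T) (sum_triples_rev A T T).
by rewrite !addn0 !add0n mulSn mul2n -addnn !addnA.
Qed.

Definition klein4 (x y : G) : {set G} := [set 0; x; y; x + y].

Lemma klein4D x y : {in klein4 x y &, forall s t, s + t \in klein4 x y}.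
Proof.
have xxy : x + (x + y) = y by rewrite addrA addxx add0r.
have xyx : x + y + x = y by rewrite addrC.
have yxy : y + (x + y) = x by rewrite addrC add2K.
move=> s t; rewrite !inE -!orbA => /or4P[] /eqP-> /or4P[] /eqP->;
  by rewrite ?(add0r, addr0, addxx, add2K, xxy, xyx, yxy, addrC y x)
             ?eqxx ?orbT.
Qed.

Lemma card_klein4 x y : x != 0 -> y != 0 -> x != y -> #|klein4 x y| = 4.
Proof.
move=> x0 y0 xy.
have xy0 : x + y != 0.
  by apply: contra xy => /eqP xy0; rewrite -(add2K x y) xy0 add0r.
rewrite /klein4 -!setUA !cardsU1 cards1 !inE !negb_or.
rewrite ![0 == _]eq_sym x0 y0 xy0 xy.
by rewrite -{1}[x]addr0 (inj_eq (addrI x)) -{2}[y]add0r (inj_eq (addIr y))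
           eq_sym y0 eq_sym x0.
Qed.

End CharacteristicTwo.

End SumTriples.

Lemma F2vec_addxx n (x : F2vec n) : x + x = 0.
Proof. by apply/rowP => i; rewrite !mxE (addrr_pchar2 (pchar_Fp _)). Qed.

Lemma subF2D n : {in subF2 n &, forall s t, s + t \in subF2 n}.
Proof.
move=> s t; rewrite !inE => /forallP s0 /forallP t0; apply/forallP => i.
apply/implyP => i0; rewrite mxE.
by rewrite (eqP (implyP (s0 i) i0)) (eqP (implyP (t0 i) i0)) addr0.
Qed.

Theorem proposition4p11 (n : nat) (hn : (2 <= n)%N)
  (A : {set F2vec n}) (hA : A \subset subF2 n :\ 0)
  (k : nat) (hcard : #|A| = k) (hk0 : (0 < k)%N) (hk : (k < 2 ^ n.-1 - 3)%N)
  (hr : r_value (compl_star A) <>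
        (#|compl_star A| * (#|compl_star A| - 1))%N) :
  exists B : {set F2vec n},
    [/\ B \subset [set: F2vec n] :\ 0,
        #|B| = (k + 4)%N &
        r_value B = (r_value A + 12)%N].
Proof.
have addxx := @F2vec_addxx n.
have [A0 sAH] : 0 \notin A /\ A \subset subF2 n.
  by move: hA; rewrite subsetD1 => /andP[].
have H0 : 0 \in subF2 n.
  by rewrite inE; apply/forallP => i; rewrite mxE eqxx implybT.
have [x [y [xC yC neq_xy xyC]]] : exists x y,
    [/\ x \in compl_star A, y \in compl_star A, x != y
      & x + y \notin compl_star A].
  have [/exists_inP[x xC /exists_inP[y yC /andP[neq_xy xyC]]]|none] :=
    boolP [exists x in compl_star A, [exists y in compl_star A,
             (x != y) && (x + y \notin compl_star A)]].
    by exists x, y.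
  case: hr; apply: r_value_sum_closed => // [|x y xC yC neq_xy].
    by rewrite !in_setD in_set1 eqxx andbF.
  apply: contraR none => xyC; apply/exists_inP; exists x => //.
  by apply/exists_inP; exists y; rewrite ?neq_xy.
have /and3P[xA x0 xH] : [&& x \notin A, x != 0 & x \in subF2 n].
  by move: xC; rewrite !in_setD in_set1.
have /and3P[yA y0 yH] : [&& y \notin A, y != 0 & y \in subF2 n].
  by move: yC; rewrite !in_setD in_set1.
have xyA : x + y \in A.
  move: xyC; rewrite !in_setD in_set1 subF2D // andbT negb_and !negbK.
  case/orP => // /eqP xy0.
  by case/eqP: neq_xy; rewrite -(add2K addxx x y) xy0 add0r.
pose V := klein4 x y.
have sVH : V \subset subF2 n.
  by apply/subsetP => s; rewrite !in_setU !in_set1 -!orbA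
    => /or4P[] /eqP-> //; apply: subF2D.
have VA : V :&: A = [set x + y].
  apply/setP => s; rewrite in_setI !in_setU !in_set1.
  have [->|_] := eqVneq s (x + y); first by rewrite orbT.
  rewrite orbF; apply/negP => /andP[/orP[/orP[]|] /eqP-> ]; exact/negP.
pose v : F2vec n := \row_i (val i == 0)%:R.
have vH : v \notin subF2 n.
  rewrite inE; apply/forallPn; exists (Ordinal (ltnW hn)).
by rewrite mxE.
have cardV : #|V| = 4 by apply: card_klein4.
pose T := [set v + s | s in V].
have TH t : t \in T -> t \notin subF2 n.
  case/imsetP => s sV ->; apply: contra vH => vsH.
  by rewrite -(add2K addxx v s) subF2D // (subsetP sVH).
exists (A :|: T); split.
- rewrite subsetD1 subsetT in_setU negb_or A0 /=.
  by apply: contraL H0; apply: TH.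
- rewrite cardsU hcard (card_imset _ (addrI v)) cardV.
  rewrite (_ : A :&: T = set0) ?cards0 ?subn0 //.
  apply/eqP; rewrite setI_eq0 disjoint_subset.
  by apply/subsetP => z /(subsetP sAH); apply/contraL/TH.
- rewrite (r_value_setU_coset addxx (@subF2D n)) //; last exact: klein4D.
  by rewrite cardV VA cards1.
Qed.
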